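(* Let $G$ be the group generated by the symbols $D$ and $T$ subject to the defining relations $$D^8=1,\quad T^8=1,\quad T^2D=DT^2,\quad TDT=D^7T^3D^7,\quad TD^5T=D^3T^7D^3.$$ Then each element of $G$ can be written in exactly one of the following forms (i.e. is equal to exactly one of the words in the following list): (W1) $1$; (W2) $D^{n_1}$; (W3) $T^{n_2}$; (W4) $D^{n_3}T^{n_4}$; (W5) $T^{p_1}D^{n_5}$; (W6) $D^{n_6}T^{p_2}D^{n_7}$; (W7) $TD^{e_1}T^{p_3}$; (W8) $D^{n_8}TD^{e_2}T^{p_4}$; where $n_1,\ldots,n_8\in\{1,2,\ldots,7\}$, $p_1,p_2,p_3,p_4\in\{1,3,5,7\}$ and $e_1,e_2\in\{2,4,6\}$, all parameters ranging independently. In particular, the order of $G$ is $384$. *)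

(* Defs.v *)
From HB Require Import structures.
From mathcomp Require Import all_boot.
From mathcomp Require Import boolp classical_sets functions cardinality.

Set Implicit Arguments.
Unset Strict Implicit.
Unset Printing Implicit Defensive.

Local Open Scope quotient_scope.

Section Presentation.

Variables (X : choiceType) (R : seq (seq (X * bool) * seq (X * bool))).

(* The letter (x, true) is the generator x, (x, false) its formal inverse. *)
Local Notation word := (seq (X * bool)).

Definition inv_letter (a : X * bool) : X * bool := (a.1, ~~ a.2).
Definition inv_word (w : word) : word := rev (map inv_letter w).

Inductive word_cong : word -> word -> Prop :=
| word_cong_rel u v : (u, v) \in R -> word_cong u v
| word_cong_inv a : word_cong [:: a; inv_letter a] [::]
| word_cong_cat u u' v v' :
    word_cong u u' -> word_cong v v' -> word_cong (u ++ v) (u' ++ v')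
| word_cong_refl u : word_cong u u
| word_cong_sym u v : word_cong u v -> word_cong v u
| word_cong_trans u v w : word_cong u v -> word_cong v w -> word_cong u w.

Definition word_congb : rel word := fun u v => `[< word_cong u v >].

Lemma word_congb_refl : reflexive word_congb.
Proof. by move=> u; apply/asboolP; exact: word_cong_refl. Qed.

Lemma word_congb_sym : symmetric word_congb.
Proof. by move=> u v; apply: asbool_equiv_eq; split; exact: word_cong_sym. Qed.

Lemma word_congb_trans : transitive word_congb.
Proof.
move=> v u w /asboolP uv /asboolP vw; apply/asboolP.
exact: word_cong_trans uv vw.
Qed.

Canonical word_cong_equiv :=
  EquivRel word_congb word_congb_refl word_congb_sym word_congb_trans.

Definition presented := {eq_quot word_cong_equiv}.

HB.instance Definition _ : EqQuotient word word_cong_equiv presented :=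
  EqQuotient.on presented.
HB.instance Definition _ := Choice.on presented.

Definition presented_one : presented := \pi_presented [::].
Definition presented_mul (g h : presented) : presented :=
  \pi_presented (repr g ++ repr h).
Definition presented_inv (g : presented) : presented :=
  \pi_presented (inv_word (repr g)).
Definition presented_gen (x : X) : presented :=
  \pi_presented [:: (x, true)].

Lemma presented_eqP u v : reflect (word_cong u v) (\pi_presented u == \pi v).
Proof. by rewrite eqmodE; exact: asboolP. Qed.

Lemma word_cong_repr u : word_cong (repr (\pi_presented u)) u.
Proof. by apply/presented_eqP; rewrite reprK. Qed.

Lemma word_cong_invl w : word_cong (inv_word w ++ w) [::].
Proof.
elim: w => [|a w IH]; first exact: word_cong_refl.
rewrite /inv_word map_cons rev_cons cat_rcons -/(inv_word w).
apply: word_cong_trans IH; apply: word_cong_cat (word_cong_refl _) _.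
rewrite -[w in word_cong _ w]cat0s -[inv_letter a :: a :: w]/([:: inv_letter a; a] ++ w).
apply: word_cong_cat (word_cong_refl _).
by have := word_cong_inv (inv_letter a); rewrite {2}/inv_letter /= negbK; case: a.
Qed.

Lemma word_cong_invr w : word_cong (w ++ inv_word w) [::].
Proof.
have {1}-> : w = inv_word (inv_word w); last exact: word_cong_invl.
rewrite /inv_word map_rev revK -map_comp map_id_in // => -[x b] _.
by rewrite /inv_letter /= negbK.
Qed.

Lemma presented_mulA : associative presented_mul.
Proof.
move=> x y z; apply/eqP/presented_eqP.
have c u v w : word_cong (u ++ (v ++ w)) ((u ++ v) ++ w).
  by rewrite catA; exact: word_cong_refl.
apply: (word_cong_trans (word_cong_cat (word_cong_refl _) (word_cong_repr _))).
apply: (word_cong_trans (c _ _ _)); apply: word_cong_cat (word_cong_refl _).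
exact/word_cong_sym/word_cong_repr.
Qed.

Lemma presented_mul1g : left_id presented_one presented_mul.
Proof.
move=> x; rewrite -[RHS]reprK; apply/eqP/presented_eqP.
exact: word_cong_cat (word_cong_repr [::]) (word_cong_refl _).
Qed.

Lemma presented_mulg1 : right_id presented_one presented_mul.
Proof.
move=> x; rewrite -[RHS]reprK; apply/eqP/presented_eqP.
rewrite -[w in word_cong _ w]cats0.
exact: word_cong_cat (word_cong_refl _) (word_cong_repr [::]).
Qed.

Lemma presented_mulVg : left_inverse presented_one presented_inv presented_mul.
Proof.
move=> x; apply/eqP/presented_eqP; apply: word_cong_trans (word_cong_invl _).
exact: word_cong_cat (word_cong_repr _) (word_cong_refl _).
Qed.

Lemma presented_mulgV : right_inverse presented_one presented_inv presented_mul.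
Proof.
move=> x; apply/eqP/presented_eqP; apply: word_cong_trans (word_cong_invr _).
exact: word_cong_cat (word_cong_refl _) (word_cong_repr _).
Qed.

HB.instance Definition _ := isGroup.Build presented presented_mulA
  presented_mul1g presented_mulg1 presented_mulVg presented_mulgV.

End Presentation.

Variant generator := genD | genT.

Definition generator_to_bool (x : generator) : bool :=
  if x is genD then true else false.
Definition generator_of_bool (b : bool) : generator := if b then genD else genT.
Lemma generator_to_boolK : cancel generator_to_bool generator_of_bool.
Proof. by case. Qed.
HB.instance Definition _ := Choice.copy generator (can_type generator_to_boolK).

Definition Dpow (n : nat) : seq (generator * bool) := nseq n (genD, true).
Definition Tpow (n : nat) : seq (generator * bool) := nseq n (genT, true).

Definition relations : seq (seq (generator * bool) * seq (generator * bool)) :=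
  [:: (Dpow 8, [::]);
      (Tpow 8, [::]);
      (Tpow 2 ++ Dpow 1, Dpow 1 ++ Tpow 2);
      (Tpow 1 ++ Dpow 1 ++ Tpow 1, Dpow 7 ++ Tpow 3 ++ Dpow 7);
      (Tpow 1 ++ Dpow 5 ++ Tpow 1, Dpow 3 ++ Tpow 7 ++ Dpow 3)].

Definition G : groupType := presented relations.
Definition D : G := presented_gen relations genD.
Definition T : G := presented_gen relations genT.

(* Listed words are represented by the form they have and its exponents. *)
Variant form :=
| W1
| W2 (n1 : nat)
| W3 (n2 : nat)
| W4 (n3 n4 : nat)
| W5 (p1 n5 : nat)
| W6 (n6 p2 n7 : nat)
| W7 (e1 p3 : nat)
| W8 (n8 e2 p4 : nat).

Definition admissible (w : form) : bool :=
  let N := [:: 1; 2; 3; 4; 5; 6; 7] in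
  let P := [:: 1; 3; 5; 7] in
  let E := [:: 2; 4; 6] in
  match w with
  | W1 => true
  | W2 n1 => n1 \in N
  | W3 n2 => n2 \in N
  | W4 n3 n4 => (n3 \in N) && (n4 \in N)
  | W5 p1 n5 => (p1 \in P) && (n5 \in N)
  | W6 n6 p2 n7 => [&& n6 \in N, p2 \in P & n7 \in N]
  | W7 e1 p3 => (e1 \in E) && (p3 \in P)
  | W8 n8 e2 p4 => [&& n8 \in N, e2 \in E & p4 \in P]
  end.

Definition form_val (w : form) : G :=
  (match w with
   | W1 => 1
   | W2 n1 => D ^+ n1
   | W3 n2 => T ^+ n2
   | W4 n3 n4 => D ^+ n3 * T ^+ n4
   | W5 p1 n5 => T ^+ p1 * D ^+ n5
   | W6 n6 p2 n7 => D ^+ n6 * T ^+ p2 * D ^+ n7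
   | W7 e1 p3 => T * D ^+ e1 * T ^+ p3
   | W8 n8 e2 p4 => D ^+ n8 * T * D ^+ e2 * T ^+ p4
   end)%g.

(* Main.v *)
(** T^2 is central, and the relations give D T D = T D^7 T and
    T D^3 T = T^4 D^5 T D^5.  Hence the products of one of D^a, D^a T D^b,
    D^a T D^(2e) T with a power of T^2 are stable under right multiplication by
    D and T, so they exhaust G, and they are exactly the listed words.
    Conversely, the 384 listed words act differently on a set of 20 points: G
    is faithfully represented by its abelianization Z/8 together with its
    quotient by <T^2>, a group of order 96 of monomial 3x3 matrices over the
    fourth roots of unity. *)
From HB Require Import structures.
Require Import Defs.
From mathcomp Require Import all_boot.
From mathcomp Require Import boolp classical_sets functions cardinality.

Set Implicit Arguments.
Unset Strict Implicit.
Unset Printing Implicit Defensive.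

Local Open Scope classical_set_scope.
Local Open Scope card_scope.

Lemma uniq_map_inj (A B : eqType) (f : A -> B) (s : seq A) :
  uniq (map f s) -> {in s &, injective f}.
Proof.
elim: s => [//|x s IH] /= /andP[fx us] y y' /predU1P[->|ys] /predU1P[->|ys'] //.
- by move=> fxy; rewrite fxy map_f in fx.
- by move=> fyx; rewrite -fyx map_f in fx.
- exact: IH.
Qed.

(** * Words, induction and actions for a presented group *)

Section Words.
Local Open Scope quotient_scope.
Variables (X : choiceType) (R : seq (seq (X * bool) * seq (X * bool))).

Lemma presented_pi_cat u v :
  \pi_(presented R) (u ++ v) =
  (\pi_(presented R) u * \pi_(presented R) v)%g.
Proof.
apply/eqP/presented_eqP/word_cong_sym.
exact: word_cong_cat (word_cong_repr _ _) (word_cong_repr _ _).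
Qed.

Lemma presented_pi_rel u v :
  (u, v) \in R -> \pi_(presented R) u = \pi_(presented R) v.
Proof. by move=> uv; apply/eqP/presented_eqP/word_cong_rel. Qed.

Lemma presented_pi_nseq n x :
  \pi_(presented R) (nseq n (x, true)) = (presented_gen R x ^+ n)%g.
Proof.
by elim: n => [//|n IH]; rewrite expgS -IH -presented_pi_cat.
Qed.

Lemma presented_pi_inv x :
  \pi_(presented R) [:: (x, false)] = (presented_gen R x)^-1%g.
Proof.
apply: (@mulgI _ (presented_gen R x)); rewrite mulgV -presented_pi_cat.
by apply/eqP/presented_eqP; exact: (word_cong_inv _ (x, true)).
Qed.

(** Letters are peeled off the right end of a representing word, to match multiplication on the
    right. *)
Lemma presented_ind (P : presented R -> Prop) :
  P 1%g ->
  (forall g x, P g -> P (g * presented_gen R x)%g) ->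
  (forall g x, P g -> P (g * (presented_gen R x)^-1)%g) ->
  forall g, P g.
Proof.
move=> P1 PM PV g; rewrite -[g]reprK.
elim/last_ind: (repr g) => [//|w [x b] IH].
rewrite -cats1 presented_pi_cat; case: b; first exact: PM.
by rewrite presented_pi_inv; exact: PV.
Qed.

(** Words act by composing their letters, so inducing the same map is itself a congruence; by
    hypothesis it contains the generating pairs. *)
Lemma word_cong_act (A : Type) (act : A -> X * bool -> A) :
  (forall p u v, (u, v) \in R -> foldl act p u = foldl act p v) ->
  (forall p a, act (act p a) (inv_letter a) = p) ->
  forall u v, word_cong R u v -> forall p, foldl act p u = foldl act p v.
Proof.
move=> actR actV u v; elim => {u v}.
- by move=> u v uv p; exact: actR.
- by move=> a p; exact: actV.
- by move=> u u' v v' _ IHu _ IHv p; rewrite !foldl_cat IHu IHv.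
- by [].
- by move=> u v _ IH p; rewrite IH.
- by move=> u v w _ IHu _ IHv p; rewrite IHu IHv.
Qed.

End Words.

Lemma expg_modn (gT : groupType) (x : gT) p k :
  (x ^+ p = 1 -> x ^+ (k %% p) = x ^+ k)%g.
Proof.
by move=> xp; rewrite {2}(divn_eq k p) expgnDr mulnC expgnA xp expg1n mul1g.
Qed.

Lemma double_mod8 e : e.*2 %% 8 = (e %% 4).*2.
Proof. by rewrite -!muln2 -(@muln_modl 2 e 4). Qed.

(** * Computation in any group satisfying the five relations *)

Section NormalForms.
Local Open Scope group_scope.
Variables (gT : groupType) (d t : gT).
Hypotheses (d8 : d ^+ 8 = 1) (t8 : t ^+ 8 = 1) (ttd : t ^+ 2 * d = d * t ^+ 2).
Hypothesis tdt : t * d * t = d ^+ 7 * t ^+ 3 * d ^+ 7.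
Hypothesis td5t : t * d ^+ 5 * t = d ^+ 3 * t ^+ 7 * d ^+ 3.

Local Notation z := (t ^+ 2).

Lemma z4 : z ^+ 4 = 1.
Proof. by rewrite -expgnA t8. Qed.

Lemma zXdX n k : z ^+ k * d ^+ n = d ^+ n * z ^+ k.
Proof. exact: commuteX2 ttd. Qed.

Lemma zXt k : z ^+ k * t = t * z ^+ k.
Proof. by rewrite -expgnA -expgS -expgSr. Qed.

Lemma tXodd p : odd p -> t ^+ p = t * z ^+ p./2.
Proof.
by move=> op; rewrite -{1}(odd_double_half p) op -mul2n expgS expgnA.
Qed.

(** In left-associated products two adjacent factors are seldom a subterm, so these rules carry the
    factor [x] on their left. *)
Lemma mul_dXdX x m n : x * d ^+ m * d ^+ n = x * d ^+ (m + n).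
Proof. by rewrite -mulgA -expgnDr. Qed.

Lemma mul_zXzX x m n : x * z ^+ m * z ^+ n = x * z ^+ (m + n).
Proof. by rewrite -mulgA -expgnDr. Qed.

Lemma mul_zXdX x k n : x * z ^+ k * d ^+ n = x * d ^+ n * z ^+ k.
Proof. by rewrite -mulgA zXdX mulgA. Qed.

Lemma mul_zXt x k : x * z ^+ k * t = x * t * z ^+ k.
Proof. by rewrite -mulgA zXt mulgA. Qed.

Lemma mul_tt x : x * t * t = x * z ^+ 1.
Proof. by rewrite -mulgA. Qed.

Lemma mul_d8 x : x * d ^+ 8 = x.
Proof. by rewrite d8 mulg1. Qed.

Lemma mul_z4 x : x * z ^+ 4 = x.
Proof. by rewrite z4 mulg1. Qed.

Lemma mul_tdXt x n : x * (t * d ^+ n * t) = x * t * d ^+ n * t.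
Proof. by rewrite !mulgA. Qed.

Lemma mul_dXtdXzX x m n k :
  x * (d ^+ m * t * d ^+ n * z ^+ k) = x * d ^+ m * t * d ^+ n * z ^+ k.
Proof. by rewrite 3!mulgA. Qed.

Lemma tdt_z : t * d ^+ 1 * t = d ^+ 7 * t * d ^+ 7 * z ^+ 1.
Proof. by rewrite expg1 tdt (@tXodd 3) // (mulgA _ t) mul_zXdX. Qed.

Lemma td5t_z : t * d ^+ 5 * t = d ^+ 3 * t * d ^+ 3 * z ^+ 3.
Proof. by rewrite td5t (@tXodd 7) // (mulgA _ t) mul_zXdX. Qed.

(* The inverse of [tdt], up to the central factor [t ^+ 2]. *)
Lemma td7t : t * d ^+ 7 * t = d ^+ 1 * t * d ^+ 1.
Proof.
(* Multiplied on the right by [t * d * t], both sides become [t ^+ 4]. *)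
apply: (@mulIg _ (t * d ^+ 1 * t)); transitivity (t * t * z ^+ 1).
  by rewrite mul_tdXt mul_tt mul_zXdX mul_dXdX mul_d8 mul_zXt.
rewrite tdt_z mul_dXtdXzX mul_dXdX mul_d8 mul_tt mul_zXdX.
by rewrite -expgnDr d8 mul1g -expg2.
Qed.

(* The inverse of [td5t], up to a central factor. *)
Lemma td3t : t * d ^+ 3 * t = d ^+ 5 * t * d ^+ 5 * z ^+ 2.
Proof.
apply: (@mulIg _ (t * d ^+ 5 * t)); transitivity (t * t * z ^+ 1).
  by rewrite mul_tdXt mul_tt mul_zXdX mul_dXdX mul_d8 mul_zXt.
rewrite td5t_z mul_dXtdXzX mul_zXdX mul_dXdX mul_d8 mul_zXt mul_tt mul_zXzX.
rewrite mul_zXdX mul_zXzX -expgnDr d8 mul1g.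
by rewrite -[2 + _ + 3]/(2 + 4) expgnDr mul_z4 -expg2 expg2.
Qed.

(** * Stability of reduced products under right multiplication *)

(** The exponent between two [t] is even because for odd [b] the product [t * d ^+ b * t] shrinks to
    some [d ^+ a * t * d ^+ a * z ^+ k]. *)
Inductive reduced : gT -> Prop :=
| reduced_D a k : reduced (d ^+ a * z ^+ k)
| reduced_DTD a b k : reduced (d ^+ a * t * d ^+ b * z ^+ k)
| reduced_DTDT a e k : reduced (d ^+ a * t * d ^+ e.*2 * t * z ^+ k).

Lemma reduced_mulDX n g : reduced g -> reduced (d ^+ n * g).
Proof. by case=> *; rewrite !mulgA -expgnDr; constructor. Qed.

Lemma reduced_mulZX g k : reduced g -> reduced (g * z ^+ k).
Proof. by case=> *; rewrite -mulgA -expgnDr; constructor. Qed.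

Lemma reduced_tdXt b : reduced (t * d ^+ b * t).
Proof.
have even_case e : reduced (t * d ^+ e.*2 * t).
  by have := reduced_DTDT 0 e 0; rewrite !expg0 mul1g mulg1.
rewrite -(expg_modn b d8); have := ltn_pmod b (isT : 0 < 8).
case: (_ %% _) => [|[|[|[|[|[|[|[|//]]]]]]]] _.
- exact: (even_case 0%N).
- by rewrite tdt_z; exact: (reduced_DTD 7 7 1).
- exact: (even_case 1%N).
- by rewrite td3t; exact: reduced_DTD.
- exact: (even_case 2%N).
- by rewrite td5t_z; exact: reduced_DTD.
- exact: (even_case 3%N).
- by rewrite td7t; have := reduced_DTD 1 1 0; rewrite mulg1.
Qed.

(** [td7t] read backwards replaces [d * t * d] by [t * d ^+ 7 * t]. For even [n.+1] the remaining
    exponent [n] is odd, so [t * d ^+ n * t] shrinks in turn. *)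
Lemma tdXStd n : t * d ^+ n.+1 * t * d = t * d ^+ n * t * d ^+ 7 * t.
Proof.
by rewrite expgSr -!(mulgA (t * d ^+ n)) td7t !expg1 !mulgA.
Qed.

Lemma reduced_tdXtd e : reduced (t * d ^+ e.*2 * t * d).
Proof.
rewrite -(expg_modn e.*2 d8) double_mod8; have := ltn_pmod e (isT : 0 < 4).
case: (_ %% _) => [|[|[|[|//]]]] _; rewrite ?tdXStd.
- rewrite mulg1 -expg2 -[d]expg1 (zXdX 1 1).
  exact: (reduced_D 1 1).
(* The middle exponent is 7 + 7, twice the second argument below; the next two cases give 5 + 7 and
   3 + 7. *)
- rewrite tdt_z mul_zXdX mul_zXt mul_dXdX.
  exact: (reduced_DTDT 7 7 1).
- rewrite td3t mul_zXdX mul_zXt mul_dXdX.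
  exact: (reduced_DTDT 5 6 2).
- rewrite td5t_z mul_zXdX mul_zXt mul_dXdX.
  exact: (reduced_DTDT 3 5 3).
Qed.

Lemma reduced_mulT g : reduced g -> reduced (g * t).
Proof.
case=> [a k|a b k|a e k]; rewrite -mulgA zXt mulgA; apply: reduced_mulZX.
- by have := reduced_DTD a 0 0; rewrite !mulg1.
- rewrite -(mulgA (d ^+ a)) -(mulgA (d ^+ a)).
  exact/reduced_mulDX/reduced_tdXt.
- by have := reduced_DTD a e.*2 1; rewrite expg1 expg2 !mulgA.
Qed.

Lemma reduced_mulD g : reduced g -> reduced (g * d).
Proof.
have ZD k : z ^+ k * d = d * z ^+ k by exact: (zXdX 1).
case=> [a k|a b k|a e k]; rewrite -mulgA ZD mulgA; apply: reduced_mulZX.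
- by rewrite -expgSr; have := reduced_D a.+1 0; rewrite mulg1.
- rewrite -[_ * _ * d]mulgA -expgSr.
  by have := reduced_DTD a b.+1 0; rewrite mulg1.
- rewrite -!mulgA; apply: reduced_mulDX; rewrite !mulgA.
  exact: reduced_tdXtd.
Qed.

(** * From reduced products to the listed words *)

Definition form_eval (w : form) : gT :=
  match w with
  | W1 => 1
  | W2 n1 => d ^+ n1
  | W3 n2 => t ^+ n2
  | W4 n3 n4 => d ^+ n3 * t ^+ n4
  | W5 p1 n5 => t ^+ p1 * d ^+ n5
  | W6 n6 p2 n7 => d ^+ n6 * t ^+ p2 * d ^+ n7
  | W7 e1 p3 => t * d ^+ e1 * t ^+ p3
  | W8 n8 e2 p4 => d ^+ n8 * t * d ^+ e2 * t ^+ p4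
  end.

Definition listed (g : gT) := exists2 w, admissible w & form_eval w = g.

Lemma listed_DT n m : listed (d ^+ n * t ^+ m).
Proof.
rewrite -(expg_modn n d8) -(expg_modn m t8).
have := ltn_pmod n (isT : 0 < 8); have := ltn_pmod m (isT : 0 < 8).
case: (n %% 8) (m %% 8) => [|n'] [|m'] mlt nlt; rewrite ?mulg1 ?mul1g.
- by exists W1.
- by exists (W3 m'.+1); rewrite //= (mem_iota 1 7).
- by exists (W2 n'.+1); rewrite //= (mem_iota 1 7).
- by exists (W4 n'.+1 m'.+1); rewrite //= !(mem_iota 1 7) nlt mlt.
Qed.

Lemma odd_exponent p : odd p -> (p %% 8 \in [:: 1; 3; 5; 7])%N.
Proof.
rewrite -(@odd_mod p 8) //; have := ltn_pmod p (isT : 0 < 8).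
by case: (p %% 8) => [|[|[|[|[|[|[|[|//]]]]]]]].
Qed.

Lemma listed_DTD n p m : odd p -> listed (d ^+ n * t ^+ p * d ^+ m).
Proof.
move=> op; rewrite -(expg_modn m d8); have := ltn_pmod m (isT : 0 < 8).
case: (m %% 8) => [|m'] mlt; first by rewrite mulg1; exact: listed_DT.
rewrite -(expg_modn n d8) -(expg_modn p t8); have := ltn_pmod n (isT : 0 < 8).
have := odd_exponent op; case: (n %% 8) => [|n'] pP nlt; rewrite ?mul1g.
- by exists (W5 (p %% 8) m'.+1); rewrite //= pP (mem_iota 1 7).
- by exists (W6 n'.+1 (p %% 8) m'.+1); rewrite //= pP !(mem_iota 1 7) nlt.
Qed.

Lemma listed_DTDT n e p : odd p -> listed (d ^+ n * t * d ^+ e.*2 * t ^+ p).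
Proof.
move=> op; rewrite -(expg_modn e.*2 d8).
have [e0|e_neq0] := eqVneq (e.*2 %% 8) 0.
  by rewrite e0 mulg1 -mulgA -expgS; exact: listed_DT.
have eE' : e.*2 %% 8 \in [:: 2; 4; 6]%N.
  move: e_neq0; rewrite double_mod8; have := ltn_pmod e (isT : 0 < 4).
  by case: (e %% 4) => [|[|[|[|]]]].
rewrite -(expg_modn n d8) -(expg_modn p t8); have := ltn_pmod n (isT : 0 < 8).
have := odd_exponent op; case: (n %% 8) => [|n'] pP nlt; rewrite ?mul1g.
- by exists (W7 (e.*2 %% 8) (p %% 8)); rewrite //= pP eE'.
- exists (W8 n'.+1 (e.*2 %% 8) (p %% 8)) => //=.
  by rewrite pP eE' (mem_iota 1 7) nlt.
Qed.

(** Absorbing the central power [z ^+ k] into a factor [t] gives the odd exponent [2k + 1], whence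
    the range 1, 3, 5, 7 modulo 8. *)
Lemma reduced_listed g : reduced g -> listed g.
Proof.
case=> [a k|a b k|a e k].
- by rewrite -expgnA; exact: listed_DT.
- have -> : d ^+ a * t * d ^+ b * z ^+ k = d ^+ a * t ^+ (k.*2.+1) * d ^+ b.
    by rewrite (@tXodd k.*2.+1) /= ?odd_double // uphalf_double mulgA mul_zXdX.
  by apply: listed_DTD; rewrite /= odd_double.
- rewrite -mulgA -expgnA -expgS mul2n.
  by apply: listed_DTDT; rewrite /= odd_double.
Qed.

End NormalForms.

(** * Exhaustion of [G] by the listed words *)

Lemma D8 : (D ^+ 8 = 1)%g.
Proof. by rewrite -presented_pi_nseq; apply: presented_pi_rel. Qed.

Lemma T8 : (T ^+ 8 = 1)%g.
Proof. by rewrite -presented_pi_nseq; apply: presented_pi_rel. Qed.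

Lemma TTD : (T ^+ 2 * D = D * T ^+ 2)%g.
Proof.
have := @presented_pi_rel _ relations (Tpow 2 ++ Dpow 1) (Dpow 1 ++ Tpow 2).
rewrite !presented_pi_cat !presented_pi_nseq !expg1; apply.
by rewrite !inE eqxx !orbT.
Qed.

Lemma TDT : (T * D * T = D ^+ 7 * T ^+ 3 * D ^+ 7)%g.
Proof.
have := @presented_pi_rel _ relations (Tpow 1 ++ Dpow 1 ++ Tpow 1)
  (Dpow 7 ++ Tpow 3 ++ Dpow 7).
by rewrite !presented_pi_cat !presented_pi_nseq !expg1 -!mulgA; apply.
Qed.

Lemma TD5T : (T * D ^+ 5 * T = D ^+ 3 * T ^+ 7 * D ^+ 3)%g.
Proof.
have := @presented_pi_rel _ relations (Tpow 1 ++ Dpow 5 ++ Tpow 1)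
  (Dpow 3 ++ Tpow 7 ++ Dpow 3).
by rewrite !presented_pi_cat !presented_pi_nseq !expg1 -!mulgA; apply.
Qed.

Lemma reducedG (g : G) : reduced D T g.
Proof.
have mulX h x n :
  reduced D T h -> reduced D T (h * presented_gen relations x ^+ n)%g.
  move=> hr; elim: n => [|n IH]; first by rewrite mulg1.
  rewrite expgSr mulgA; case: x IH => IH.
    exact: (reduced_mulD D8 T8 TTD TDT TD5T IH).
  exact: (reduced_mulT D8 T8 TTD TDT TD5T IH).
(* Inverse letters reduce to positive ones, the eighth powers of both generators being trivial. *)
have genV x :
  (presented_gen relations x)^-1%g = (presented_gen relations x ^+ 7)%g.
  apply: (@mulgI _ (presented_gen relations x)); rewrite mulgV -expgS.
  by case: x; rewrite ?D8 ?T8.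
elim/presented_ind: g => [|g x gr|g x gr].
- by have := reduced_D D T 0 0; rewrite mulg1.
- exact: (mulX g x 1 gr).
- by rewrite genV; exact: mulX.
Qed.

Lemma form_val_surj (g : G) : exists2 w, admissible w & form_val w = g.
Proof.
have [w adm <-] := reduced_listed D8 T8 TTD (reducedG g).
by exists w; case: w adm.
Qed.

(** * The action of [G] on 20 points *)

(* The points [0 .. 7] form Z/8, on which [D] and [T] act as translations by
   [1] and [3]; the point [8 + 4 * j + k] is the multiple [i ^ k e_j] of a basis
   vector of C^3, on which [D] and [T] act by the monomial matrices
   e_0 -> e_1 -> i e_0, e_2 -> -i e_2 and e_0 -> e_0, e_1 <-> e_2. *)
Definition generator_table (x : generator) : seq nat :=
  match x with
  | genD => [:: 1; 2; 3; 4; 5; 6; 7; 0;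
                12; 13; 14; 15; 9; 10; 11; 8; 19; 16; 17; 18]
  | genT => [:: 3; 4; 5; 6; 7; 0; 1; 2;
                8; 9; 10; 11; 16; 17; 18; 19; 12; 13; 14; 15]
  end.

(* The default value [q] of [nth] makes all points from [20] on fixed. Inverse
   letters act as seventh powers, both generators having order 8. *)
Definition letter_act (p : nat) (a : generator * bool) : nat :=
  iter (if a.2 then 1 else 7) (fun q => nth q (generator_table a.1) q) p.

Lemma letter_act_fix w p : 20 <= p -> foldl letter_act p w = p.
Proof.
move=> p20; elim: w => [//|a w IH] /=; suff -> : letter_act p a = p by [].
have pfix x : nth p (generator_table x) p = p by case: x; rewrite nth_default.
by case: a => x [] /=; rewrite /letter_act /= ?pfix.
Qed.

(** [word_cong_act] asks for equality at every natural number; this leaves 20 values to evaluate. *)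
Lemma foldl_letter_act_eq u v :
  all (fun p => foldl letter_act p u == foldl letter_act p v) (iota 0 20) ->
  foldl letter_act ^~ u =1 foldl letter_act ^~ v.
Proof.
move=> /allP uv p; have [p20|p20] := ltnP p 20; last by rewrite !letter_act_fix.
by apply/eqP/uv; rewrite mem_iota.
Qed.

Definition word_image (w : seq (generator * bool)) : seq nat :=
  [seq foldl letter_act p w | p <- iota 0 20].

Lemma word_cong_image u v :
  word_cong relations u v -> word_image u = word_image v.
Proof.
move=> uv; apply: eq_map => p; move: u v uv p.
apply: word_cong_act => [p u v uv|p a].
  apply: foldl_letter_act_eq; move: uv; rewrite !inE.
  by do 4?[case/orP]; move=> /eqP[-> ->].
apply: (@foldl_letter_act_eq [:: a; inv_letter a] [::]).
by case: a => [] [] [].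
Qed.

Definition form_word (w : form) : seq (generator * bool) :=
  match w with
  | W1 => [::]
  | W2 n1 => Dpow n1
  | W3 n2 => Tpow n2
  | W4 n3 n4 => Dpow n3 ++ Tpow n4
  | W5 p1 n5 => Tpow p1 ++ Dpow n5
  | W6 n6 p2 n7 => Dpow n6 ++ Tpow p2 ++ Dpow n7
  | W7 e1 p3 => Tpow 1 ++ Dpow e1 ++ Tpow p3
  | W8 n8 e2 p4 => Dpow n8 ++ Tpow 1 ++ Dpow e2 ++ Tpow p4
  end.

Lemma form_valE w : form_val w = \pi_(presented relations)%qT (form_word w).
Proof.
case: w => *; rewrite /form_val /form_word;
  by rewrite ?presented_pi_cat ?presented_pi_nseq ?expg1 ?mulgA.
Qed.

(** * Enumeration of the forms and the order of [G] *)

(** This encoding transports decidable equality to [form]. *)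
Definition form_code (w : form) : seq nat :=
  match w with
  | W1 => [:: 1]
  | W2 n1 => [:: 2; n1]
  | W3 n2 => [:: 3; n2]
  | W4 n3 n4 => [:: 4; n3; n4]
  | W5 p1 n5 => [:: 5; p1; n5]
  | W6 n6 p2 n7 => [:: 6; n6; p2; n7]
  | W7 e1 p3 => [:: 7; e1; p3]
  | W8 n8 e2 p4 => [:: 8; n8; e2; p4]
  end.

Lemma form_code_inj : injective form_code.
Proof.
case=> [|?|?|? ?|? ?|? ? ?|? ?|? ? ?];
  by case=> [|?|?|? ?|? ?|? ? ?|? ?|? ? ?] // []; do ?move=> ->.
Qed.

HB.instance Definition _ := Equality.copy form (inj_type form_code_inj).

(** The length is 1 + 7 + 7 + 49 + 28 + 196 + 12 + 84 = 384. *)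
Definition forms : seq form :=
  let N := [:: 1; 2; 3; 4; 5; 6; 7] in
  let P := [:: 1; 3; 5; 7] in
  let E := [:: 2; 4; 6] in
  [:: W1] ++ [seq W2 n | n <- N] ++ [seq W3 n | n <- N]
  ++ [seq W4 n m | n <- N, m <- N] ++ [seq W5 p n | p <- P, n <- N]
  ++ [seq W6 n x.1 x.2 | n <- N, x <- [seq (p, m) | p <- P, m <- N]]
  ++ [seq W7 e p | e <- E, p <- P]
  ++ [seq W8 n x.1 x.2 | n <- N, x <- [seq (e, p) | e <- E, p <- P]].

Lemma mem_forms w : admissible w -> w \in forms.
Proof.
(* With concrete lists, [mem_cat] would unfold [forms] completely. *)
rewrite /admissible /forms.
move: [:: 1; 2; 3; 4; 5; 6; 7] [:: 1; 3; 5; 7] [:: 2; 4; 6] => N P E /=.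
rewrite inE !mem_cat; case: w => [|n|m|n m|p m|n p m|e p|n e p] adm //.
- by rewrite (map_f W2 adm) ?orbT.
- by rewrite (map_f W3 adm) ?orbT.
- by case/andP: adm => nN mN; rewrite (allpairs_f W4 nN mN) ?orbT.
- by case/andP: adm => pP mN; rewrite (allpairs_f W5 pP mN) ?orbT.
- case/and3P: adm => nN pP mN.
  have xN := allpairs_f pair pP mN.
  by rewrite (allpairs_f (fun n x => W6 n x.1 x.2) nN xN) ?orbT.
- by case/andP: adm => eE pP; rewrite (allpairs_f W7 eE pP) ?orbT.
- case/and3P: adm => nN eE pP.
  have xN := allpairs_f pair eE pP.
  by rewrite (allpairs_f (fun n x => W8 n x.1 x.2) nN xN) ?orbT.
Qed.

(** This computation is the lower bound on the order: congruent words have equal images, so distinct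
    images separate the listed elements. *)
Lemma uniq_form_images : uniq [seq word_image (form_word w) | w <- forms].
Proof. by vm_compute. Qed.

Lemma form_image_eq w w' : form_val w = form_val w' ->
  word_image (form_word w) = word_image (form_word w').
Proof.
by rewrite !form_valE => /eqP/presented_eqP; exact: word_cong_image.
Qed.

Lemma form_val_inj : {in forms &, injective form_val}.
Proof.
move=> w w' wf wf' /form_image_eq.
exact: uniq_map_inj uniq_form_images w w' wf wf'.
Qed.

Lemma uniq_form_vals : uniq [seq form_val w | w <- forms].
Proof.
rewrite map_inj_in_uniq; last exact: form_val_inj.
by apply: (@map_uniq _ _ (word_image \o form_word)); exact: uniq_form_images.
Qed.

Lemma mem_form_vals (g : G) : g \in [seq form_val w | w <- forms].
Proof. by have [w /mem_forms wf <-] := form_val_surj g; exact: map_f. Qed.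

Theorem theorem2p1 :
  (forall g : G, exists! w : form, admissible w /\ form_val w = g) /\
  [set: G] #= `I_384.
Proof.
split=> [g|].
  have [w adm wg] := form_val_surj g; exists w; split=> // w' [adm' wg'].
  by apply: form_val_inj; rewrite ?mem_forms // wg.
have : size [seq form_val w | w <- forms] = 384 by rewrite size_map.
(* Three facts about the list suffice: its entries are distinct, they exhaust [G], and there are 384
   of them. The position in the list is then the bijection. *)
move: (map _ _) uniq_form_vals mem_form_vals => vals vals_uniq vals_all vals_size.
apply/card_set_bijP; exists (index ^~ vals); split.
- by move=> g _ /=; rewrite -vals_size index_mem.
- by move=> g h _ _; exact: index_inj.
- move=> i /=; rewrite -vals_size => ilt.
  by exists (nth 1%g vals i); rewrite ?index_uniq.
Qed.
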